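(* Let $X_1,\dots,X_n$ be independent nonnegative lifetimes with common absolutely continuous distribution function $F(\cdot,\theta)$ depending on parameter(s) $\theta$. Let $l,r\in\{1,\dots,n\}$ with $l<r$, and let $0<T_1<T_2<\infty$. Let $\xi$ be the duration of the test under the Type-II unified hybrid censoring scheme with design parameters $(n,r,l,T_1,T_2)$. Then, with expectations taken in $[0,\infty]$, $$E[\xi]=E[X_{l:n}]+T_1+C_{X_{r:n}\wedge T_2}-C_{X_{l:n}\wedge T_2}-C_{X_{r:n}\wedge T_1},$$ where $C_{X_{r:n}\wedge T_2}$, $C_{X_{l:n}\wedge T_2}$ and $C_{X_{r:n}\wedge T_1}$ denote the expected durations of the test under the Type-I hybrid censoring schemes $(r,T_2)$, $(l,T_2)$ and $(r,T_1)$, respectively.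
   Context: Notation: $X_{1:n}<X_{2:n}<\cdots<X_{n:n}$ are the (almost surely distinct) order statistics of $X_1,\dots,X_n$, i.e. the ordered failure times of the $n$ units placed on test; $x\wedge y=\min(x,y)$ and $x\vee y=\max(x,y)$. Type-II unified hybrid censoring scheme (Type-II UHCS) with parameters $(n,r,l,T_1,T_2)$: the test is terminated at the random time $\xi$ (the duration of the test) given (outside a null event) by - $\xi=T_1$ if $X_{l:n}<X_{r:n}<T_1<T_2$; - $\xi=X_{r:n}$ if $X_{l:n}<T_1<X_{r:n}<T_2$; - $\xi=T_2$ if $X_{l:n}<T_1<T_2<X_{r:n}$; - $\xi=X_{r:n}$ if $T_1<X_{l:n}<X_{r:n}<T_2$; - $\xi=T_2$ if $T_1<X_{l:n}<T_2<X_{r:n}$; - $\xi=X_{l:n}$ if $T_1<T_2<X_{l:n}<X_{r:n}$. Equivalently $\xi=(X_{l:n}\vee T_2)\wedge(X_{r:n}\vee T_1)$. Type-I hybrid censoring scheme $(k,T)$, with $k\in\{1,\dots,n\}$ and $T>0$: the test on the same $n$ units is terminated at time $X_{k:n}\wedge T$. Its expected duration is $C_{X_{k:n}\wedge T}=E[X_{k:n}\wedge T]$. *)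

(* Defs.v *)
From HB Require Import structures.
From mathcomp Require Import all_boot all_order all_algebra.
From mathcomp Require Import all_classical all_reals all_analysis.

Set Implicit Arguments.
Unset Strict Implicit.
Unset Printing Implicit Defensive.

Import Order.TTheory GRing.Theory Num.Theory.
Import numFieldNormedType.Exports.

Local Open Scope classical_set_scope.
Local Open Scope ring_scope.

(* Product rule over every subfamily [J], so that this is mutual, not merely
   pairwise, independence. *)
Definition mutually_independent (d : measure_display) (T : measurableType d)
    (R : realType) (P : probability T R) (I : finType)
    (X : I -> {RV P >-> R}) : Prop :=
  forall (J : {set I}) (B : I -> set R),
    (forall i, i \in J -> measurable (B i)) ->
    P (\bigcap_(i in [set` J]) (X i @^-1` B i)) =
    (\prod_(i in J) P (X i @^-1` B i))%E.

(* Absolute continuity of a distribution function in the usual sense of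
   probability theory: it is the primitive from -oo of a density. *)
Definition absolutely_continuous_df (R : realType) (F : R -> R) : Prop :=
  exists f : R -> R,
    [/\ measurable_fun [set: R] f,
        forall t, 0 <= f t
      & forall x,
          (F x)%:E = (\int[lebesgue_measure]_(t in `]-oo, x]) (f t)%:E)%E].

(* X_{k:n}: [k] is counted from 1, whereas [nth] counts from 0; the default
   value 0 is only returned when [k > n]. *)
Definition order_stat (d : measure_display) (T : measurableType d)
    (R : realType) (P : probability T R) (n : nat)
    (X : 'I_n -> {RV P >-> R}) (k : nat) (w : T) : R :=
  nth 0 (sort <=%R [seq X i w | i : 'I_n]) k.-1.

Definition typeI_hcs_duration (d : measure_display) (T : measurableType d)
    (R : realType) (P : probability T R) (n : nat)
    (X : 'I_n -> {RV P >-> R}) (k : nat) (tau : R) (w : T) : R :=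
  Num.min (order_stat X k w) tau.

Definition typeI_hcs_cost (d : measure_display) (T : measurableType d)
    (R : realType) (P : probability T R) (n : nat)
    (X : 'I_n -> {RV P >-> R}) (k : nat) (tau : R) : \bar R :=
  ('E_P[typeI_hcs_duration X k tau])%E.

(* The termination rule constrains the duration [x] only when the order
   statistics [xl], [xr] and the times [T1], [T2] are pairwise distinct. *)
Definition typeII_uhcs_rule (R : realType) (T1 T2 xl xr x : R) : Prop :=
  ([&& xl < xr, xr < T1 & T1 < T2] -> x = T1) /\
  ([&& xl < T1, T1 < xr & xr < T2] -> x = xr) /\
  ([&& xl < T1, T1 < T2 & T2 < xr] -> x = T2) /\
  ([&& T1 < xl, xl < xr & xr < T2] -> x = xr) /\
  ([&& T1 < xl, xl < T2 & T2 < xr] -> x = T2) /\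
  ([&& T1 < T2, T2 < xl & xl < xr] -> x = xl).

Definition typeII_uhcs_duration (d : measure_display) (T : measurableType d)
    (R : realType) (P : probability T R) (n : nat)
    (X : 'I_n -> {RV P >-> R}) (r l : nat) (T1 T2 : R)
    (xi : {RV P >-> R}) : Prop :=
  {ae P, forall w,
    typeII_uhcs_rule T1 T2 (order_stat X l w) (order_stat X r w) (xi w)}.

(* Main.v *)
(* A common density makes the law of each lifetime atomless, so independence
   excludes ties: almost surely X_{l:n} < X_{r:n} and neither of them equals T1
   or T2. In each of the six cases of the termination rule one then checks
     xi + X_{l:n} /\ T2 + X_{r:n} /\ T1 = X_{l:n} + T1 + X_{r:n} /\ T2,
   where all summands are nonnegative. Taking expectations, the two Type-I
   costs on the left are finite and can be subtracted, even when E[X_{l:n}] and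
   E[xi] are infinite. *)

Require Import Defs.
From HB Require Import structures.
From mathcomp Require Import all_boot all_order all_algebra.
From mathcomp Require Import all_classical all_reals all_analysis.
From mathcomp Require Import measurable_realfun lra.

Import Order.TTheory GRing.Theory Num.Theory.
Import numFieldNormedType.Exports.

Local Open Scope classical_set_scope.
Local Open Scope ring_scope.

Set Implicit Arguments.
Unset Strict Implicit.

(** In a sorted list the entries below [x] form an initial segment whose length is the count, and
    [k.-1] is the position counted from 0. This turns events about order statistics into events
    about a sum of indicators. *)
Lemma order_stat_lt_count (d : measure_display) (T : measurableType d)
    (R : realType) (P : probability T R) (n : nat) (X : 'I_n -> {RV P >-> R})
    (k : nat) (w : T) (x : R) : (k.-1 < n)%N ->
  (order_stat X k w < x) = (k.-1 < \sum_(i < n) (X i w < x)%R)%N.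
Proof.
move=> kn; rewrite /order_stat; set s := [seq X i w | i : 'I_n].
have -> : (\sum_(i < n) (X i w < x)%R = count (< x) (sort <=%R s))%N.
  rewrite (permP (permEl (perm_sort _ _))) /s /image_mem count_map -sum1_count.
  rewrite big_enum_cond [RHS]big_mkcond /=.
  by apply: eq_bigr => i _; case: (_ < _).
have ss : sorted <=%O (sort <=%R s) by exact: sort_le_sorted.
have [kc|ck] := ltnP k.-1; first by rewrite nth_count_lt.
by rewrite ltNge nth_count_ge// ck size_sort size_map -cardE card_ord.
Qed.

Lemma measurable_order_stat (d : measure_display) (T : measurableType d)
    (R : realType) (P : probability T R) (n : nat) (X : 'I_n -> {RV P >-> R})
    (k : nat) : (k.-1 < n)%N -> measurable_fun [set: T] (order_stat X k).
Proof.
(* The rays []-oo, x[] generate the Borel sets, and the preimage of such a ray is a superlevel set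
   of the count [g]. *)
move=> kn mT; apply: (measurability _ (RGenInftyO.measurableE R)) => //.
move=> _ [_ [x ->] <-]; rewrite setTI.
pose g (w : T) : R := \sum_(i < n) (X i w < x)%R%:R.
have mg : measurable_fun [set: T] g.
  apply: measurable_sum => i.
  rewrite (_ : (fun w => _) = \1_(X i @^-1` `]-oo, x[)).
    by apply: measurable_indic; exact: measurable_funPTI.
  apply/funext => w; rewrite indicE; congr ((nat_of_bool _)%:R).
  by apply/idP/idP => [h|]; rewrite inE /= in_itv.
rewrite (_ : _ @^-1` _ = g @^-1` `]k.-1%:R, +oo[).
  by rewrite -[X in measurable X]setTI; exact: mg.
apply/funext => w /=; rewrite !in_itv /= andbT order_stat_lt_count// /g.
by rewrite -natr_sum ltr_nat.
Qed.

Lemma absolutely_continuous_df_atomless (R : realType) (d : measure_display)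
    (T : measurableType d) (P : probability T R) (F : R -> R)
    (X : {RV P >-> R}) :
  (forall x, cdf X x = (F x)%:E) -> absolutely_continuous_df F ->
  forall a, distribution P X [set a] = 0.
Proof.
move=> XF [f [mf f0 Ff]] a.
apply/eqP; rewrite eq_le measure_ge0 andbT; apply/lee_addgt0Pr => e e0.
rewrite add0e.
(* Truncated at [a], the density has the finite integral [F a], so absolute continuity of the
   integral applies to it. *)
pose g := f \_ `]-oo, a].
have mi (x y : R) : measurable (`]x, y]%classic : set R) by [].
have mfE D : measurable_fun D (EFin \o f).
  by apply/measurable_EFinP; exact: measurable_funTS.
have ig : lebesgue_measure.-integrable [set: R] (EFin \o g).
  have -> : EFin \o g = (EFin \o f) \_ `]-oo, a].
    by rewrite /g; apply/funext => x /=; rewrite /patch; case: ifP.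
  apply/integrable_restrict => //; rewrite setTI.
  apply/integrableP; split; first exact: mfE.
  under eq_integral do rewrite /= ger0_norm//.
  by rewrite -Ff ltry.
have [δ [δ0 Hδ]] := integral_normr_continuous ig e0.
(* [{a}] is contained in [`]b, a]], whose mass is the integral of the density
   over a set of small Lebesgue measure. *)
pose b : R := a - δ / 2.
have h0 : b < a by rewrite /b; lra.
have le1 : (distribution P X [set a] <= distribution P X `]b, a])%E.
  apply: le_measure; rewrite ?inE// => x /= ->.
  by rewrite in_itv /= lexx h0.
apply: (le_trans le1).
have UI : `]-oo, a]%classic = `]-oo, b] `|` `]b, a] :> set R.
  by rewrite -itv_bndbnd_setU// ?bnd_simp ?ltW.
have DI : [disjoint `]-oo, b]%classic & `]b, a] : set R].
  apply/disj_setPLR => x /=; rewrite !in_itv /= => xb; apply/negP.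
  by rewrite negb_and -leNgt xb.
have cdfD : (cdf X a = cdf X b + distribution P X `]b, a])%E.
  by rewrite /cdf UI measureU//; exact/disj_set2P.
have FD : (F a)%:E = ((F b)%:E +
    \int[lebesgue_measure]_(t in `]b, a]) (f t)%:E)%E.
  rewrite !Ff UI ge0_integral_setU//=; first exact: mfE.
  by move=> x _; rewrite lee_fin.
(* The law and the density integral over []-oo, a]], both split at [b], share the finite term [F b],
   which cancels. *)
have vE : distribution P X `]b, a] =
    (\int[lebesgue_measure]_(t in `]b, a]) (f t)%:E)%E.
  have fa : cdf X b \is a fin_num by rewrite XF.
  rewrite -[LHS](addeK _ fa) -[RHS](addeK _ fa); congr (_ - _)%E.
  by rewrite addeC -cdfD XF FD -XF addeC.
have /Hδ : (lebesgue_measure (`]b, a]%classic : set R) < δ%:E)%E.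
  by rewrite lebesgue_measure_itv /= lte_fin h0 lte_fin /b; lra.
move=> /(_ (mi _ _)).
rewrite /Rintegral.
under eq_integral => x xA.
  rewrite (_ : `|g x| = f x).
  over.
  rewrite /g patchE mem_set ?ger0_norm//=.
  by move: xA; rewrite inE /= !in_itv /= => /andP[].
rewrite -vE -lte_fin fineK; first exact: ltW.
by rewrite fin_num_measure.
Qed.

(** Without ties, [T1 < T2] and [xl < xr] leave six consistent orderings, one for each clause of the
    rule; in each of them the minima are explicit and the identity is linear. The other sign
    patterns are contradictory. *)
Lemma typeII_uhcs_rule_min (R : realType) (T1 T2 xl xr x : R) :
  T1 < T2 -> xl < xr -> xl != T1 -> xl != T2 -> xr != T1 -> xr != T2 ->
  typeII_uhcs_rule T1 T2 xl xr x ->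
  x + Num.min xl T2 + Num.min xr T1 = xl + T1 + Num.min xr T2.
Proof.
move=> T12 lr l1 l2 r1 r2 [h1 [h2 [h3 [h4 [h5 h6]]]]].
case: (ltgtP xl T1) l1 h1 h2 h3 h4 h5 h6 => // l1 _;
case: (ltgtP xl T2) l2 => // l2 _;
case: (ltgtP xr T1) r1 => // r1 _;
case: (ltgtP xr T2) r2 => // r2 _; rewrite ?T12 ?lr /=;
move=> h1 h2 h3 h4 h5 h6; rewrite /Num.min; lra.
Qed.

Lemma independent_pair_neq (R : realType) (d : measure_display)
    (T : measurableType d) (P : probability T R) (X Y : {RV P >-> R}) :
  (forall A B : set R, measurable A -> measurable B ->
    P (X @^-1` A `&` Y @^-1` B) = P (X @^-1` A) * P (Y @^-1` B))%E ->
  (forall a, distribution P Y [set a] = 0)%E ->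
  {ae P, forall w, X w != Y w}.
Proof.
move=> indep Y0.
pose D := [set z : R * R | z.1 == z.2].
have mD : measurable D.
  have : measurable_fun [set: R * R] (fun z : R * R => z.1 == z.2).
    by apply: measurable_fun_eqr.
  by move=> /(_ measurableT [set true] I); rewrite setTI.
have mZ : measurable_fun [set: T] (fun w => (X w, Y w)).
  exact: measurable_fun_pair.
pose Z : {mfun T >-> (R * R)%type} := HB.pack (fun w => (X w, Y w))
  (isMeasurableFun.Build _ _ _ _ _ mZ).
(* The joint law is the product of the marginals, and a product with an
   atomless factor does not charge the diagonal. *)
have /(_ D mD) PZ := @product_measure_unique _ _ _ _ R (distribution P X)
  (distribution P Y) (distribution P Z) indep.
exists (Z @^-1` D); split.
- exact: measurable_funPTI.
- rewrite -[LHS]/(distribution P Z D) -PZ /= /product_measure1.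
  rewrite integral0_eq// => x _ /=.
  rewrite -(Y0 x); congr (distribution P Y _); apply/seteqP.
  by split => y; rewrite /xsection /= /D ?inE /=; [move/eqP|move=> ->].
- by move=> w /= /negP; rewrite negbK.
Qed.

(** Transfers to order statistics the pathwise properties shared by all observations, here
    nonnegativity and avoidance of [T1] and [T2]. *)
Lemma order_stat_is_observation (d : measure_display) (T : measurableType d)
    (R : realType) (P : probability T R) (n : nat) (X : 'I_n -> {RV P >-> R})
    (k : nat) (w : T) : (k.-1 < n)%N -> exists i, order_stat X k w = X i w.
Proof.
move=> kn; have : order_stat X k w \in [seq X i w | i : 'I_n].
  by rewrite -(mem_sort <=%R) mem_nth// size_sort size_map -cardE card_ord.
by move=> /mapP[i _ ->]; exists i.
Qed.

(** Without ties the sorted list is duplicate-free, hence strictly sorted. The bound [0 < l] matters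
    because [k.-1] sends both 0 and 1 to position 0. *)
Lemma order_stat_increasing (d : measure_display) (T : measurableType d)
    (R : realType) (P : probability T R) (n : nat) (X : 'I_n -> {RV P >-> R})
    (l r : nat) (w : T) : injective (fun i => X i w) ->
  (0 < l)%N -> (l < r)%N -> (r <= n)%N -> order_stat X l w < order_stat X r w.
Proof.
move=> Xinj l0 lr rn; rewrite /order_stat.
have szs : size (sort <=%R [seq X i w | i : 'I_n]) = n.
  by rewrite size_sort size_map -cardE card_ord.
rewrite lt_sorted_ltn_nth ?inE ?szs.
- by rewrite -ltnS !prednK// (leq_trans _ lr).
- rewrite lt_sorted_uniq_le sort_uniq sort_le_sorted andbT.
  by rewrite map_inj_uniq ?enum_uniq.
- by rewrite (leq_ltn_trans (leq_pred _))// (leq_trans lr).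
- by rewrite prednK// (leq_trans _ lr).
Qed.

Lemma mutually_independent_pair (d : measure_display) (T : measurableType d)
    (R : realType) (P : probability T R) (I : finType)
    (X : I -> {RV P >-> R}) (i j : I) (A B : set R) :
  mutually_independent X -> i != j -> measurable A -> measurable B ->
  (P (X i @^-1` A `&` X j @^-1` B) = P (X i @^-1` A) * P (X j @^-1` B))%E.
Proof.
move=> indep ij mA mB.
have ji : (j == i) = false by rewrite eq_sym (negbTE ij).
(* The family of events takes [A] at [i] and [B] at every other index; since [i != j], the index [j]
   receives [B]. *)
have := indep [set i; j]%SET (fun k => if k == i then A else B).
rewrite big_setU1 ?inE//= big_set1 eqxx ji => <- => [|k _]; last by case: ifP.
congr (P _); apply/seteqP; split => [w [XA XB] k /=|w XAB].
  by rewrite !inE => /orP[] /eqP ->; rewrite ?eqxx ?ji.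
split; first by have := XAB i; rewrite /= !inE !eqxx; apply.
by have := XAB j; rewrite /= !inE ji eqxx orbT; apply.
Qed.

Lemma ae_eq_expectation (d : measure_display) (T : measurableType d)
    (R : realType) (P : probability T R) (f g : T -> R) :
  measurable_fun [set: T] f -> measurable_fun [set: T] g ->
  {ae P, forall w, f w = g w} -> ('E_P[f] = 'E_P[g])%E.
Proof.
move=> mf mg fg; rewrite unlock; apply: ae_eq_integral => //.
- exact/measurable_EFinP.
- exact/measurable_EFinP.
- by apply: filterS fg => w /= -> _.
Qed.

(* The library's [expectationD] requires both summands to be integrable. *)
Lemma ae_ge0_expectationD (d : measure_display) (T : measurableType d)
    (R : realType) (P : probability T R) (f g : T -> R) :
  measurable_fun [set: T] f -> measurable_fun [set: T] g ->
  {ae P, forall w, 0 <= f w} -> {ae P, forall w, 0 <= g w} ->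
  ('E_P[f \+ g] = 'E_P[f] + 'E_P[g])%E.
Proof.
move=> mf mg f0 g0.
have mp (h : T -> R) :
    measurable_fun [set: T] h -> measurable_fun [set: T] (h^\+)%R.
  exact: measurable_funrpos.
(* Positive parts agree almost surely with the functions and are nonnegative everywhere, as
   additivity of the integral requires. *)
have fE : {ae P, forall w, f w = f^\+ w}.
  by apply: filterS f0 => w fw0; rewrite /funrpos max_l.
have gE : {ae P, forall w, g w = g^\+ w}.
  by apply: filterS g0 => w gw0; rewrite /funrpos max_l.
rewrite (ae_eq_expectation mf (mp _ mf) fE) (ae_eq_expectation mg (mp _ mg) gE).
rewrite (@ae_eq_expectation _ _ _ P _ (f^\+ \+ g^\+)); last first.
- by apply: filterS2 fE gE => w /= -> ->.
- by apply: measurable_funD; exact: mp.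
- exact: measurable_funD.
rewrite unlock /= -ge0_integralD//=.
- by move=> w _; rewrite lee_fin.
- exact/measurable_EFinP/mp.
- by move=> w _; rewrite lee_fin.
- exact/measurable_EFinP/mp.
Qed.

(** The expectations of [f] and [c - f] add up to the finite number [c], which forces both to be
    finite. *)
Lemma ae_bounded_expectation_fin_num (d : measure_display)
    (T : measurableType d) (R : realType) (P : probability T R) (f : T -> R)
    (c : R) : measurable_fun [set: T] f ->
  {ae P, forall w, 0 <= f w} -> {ae P, forall w, f w <= c} ->
  'E_P[f]%E \is a fin_num.
Proof.
move=> mf f0 fc.
have mcf : measurable_fun [set: T] (cst c \- f) by exact: measurable_funB.
have cf0 : {ae P, forall w, 0 <= (cst c \- f) w}.
  by apply: filterS fc => w fc; rewrite /= subr_ge0.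
have : ('E_P[f] + 'E_P[cst c \- f])%E \is a fin_num.
  rewrite -ae_ge0_expectationD// (_ : f \+ _ = cst c) ?expectation_cst//.
  by apply/funext => w /=; rewrite addrC subrK.
by rewrite fin_numD => /andP[].
Qed.

Unset Implicit Arguments.
Set Strict Implicit.

Theorem theorem2 (R : realType) (d : measure_display) (T : measurableType d)
    (P : probability T R) (Theta : Type) (F : R -> Theta -> R) (theta : Theta)
    (n : nat) (X : 'I_n -> {RV P >-> R}) (l r : nat) (T1 T2 : R)
    (xi : {RV P >-> R}) :
  mutually_independent X ->
  (forall i : 'I_n, {ae P, forall w, 0 <= X i w}) ->
  (forall (i : 'I_n) (x : R), cdf (X i) x = (F x theta)%:E) ->
  absolutely_continuous_df (fun x => F x theta) ->
  (1 <= l <= n)%N -> (1 <= r <= n)%N -> (l < r)%N ->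
  0 < T1 -> T1 < T2 ->
  typeII_uhcs_duration X r l T1 T2 xi ->
  ('E_P[xi] = 'E_P[order_stat X l] + T1%:E + typeI_hcs_cost X r T2
              - typeI_hcs_cost X l T2 - typeI_hcs_cost X r T1)%E.
Proof.
move=> indep X0 XF acF /andP[l1 ln] /andP[r1 rn] lr T10 T12 xiE.
have T20 : 0 < T2 by exact: lt_trans T12.
have ln' : (l.-1 < n)%N by rewrite prednK.
have rn' : (r.-1 < n)%N by rewrite prednK.
have ml := measurable_order_stat X ln'.
have X0' : {ae P, forall w, forall i, 0 <= X i w} by exact: filter_forall.
have atomless i a : distribution P (X i) [set a] = 0%E.
  exact: absolutely_continuous_df_atomless (XF i) acF a.
(* The quantifier over [i] stays inside the almost sure event, since the unit that realises an order
   statistic varies with [w]. *)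
have Xneq a : {ae P, forall w, forall i, X i w != a}.
  apply: filter_forall => i; exists (X i @^-1` [set a]); split.
  - exact: measurable_funPTI.
  - exact: atomless.
  - by move=> w /= /negP; rewrite negbK => /eqP.
(* Each pair of distinct units ties with probability zero, and there are finitely many pairs. *)
have Xinj : {ae P, forall w, injective (fun i => X i w)}.
  have : {ae P, forall w, forall i j, i != j -> X i w != X j w}.
    apply: filter_forall => i; apply: filter_forall => j.
    have [->|ij] := eqVneq i j; first by apply: aeW => w.
    have Xij : {ae P, forall w, X i w != X j w}.
      apply: independent_pair_neq (atomless j) => A B.
      exact: mutually_independent_pair.
    by apply: filterS Xij => w.
  apply: filterS => w Xw i j /= Xij; apply/eqP; apply: contraT => /Xw.
  by rewrite Xij eqxx.
have os0 k : (k.-1 < n)%N -> {ae P, forall w, 0 <= order_stat X k w}.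
  move=> kn; apply: filterS X0' => w X0w.
  by have [i ->] := order_stat_is_observation X w kn.
have mmin k c : (k.-1 < n)%N ->
    measurable_fun [set: T] (typeI_hcs_duration X k c).
  move=> kn; apply: measurable_minr => //; exact: measurable_order_stat.
have min0 k c : (k.-1 < n)%N -> 0 < c ->
    {ae P, forall w, 0 <= typeI_hcs_duration X k c w}.
  move=> kn c0; apply: filterS (os0 k kn) => w osw.
  by rewrite /typeI_hcs_duration le_min osw ltW.
have minfin k c : (k.-1 < n)%N -> 0 < c ->
    typeI_hcs_cost X k c \is a fin_num.
  move=> kn c0; apply: (@ae_bounded_expectation_fin_num _ _ _ _ _ c).
  - exact: mmin.
  - exact: min0.
  - by apply: aeW => w; rewrite /typeI_hcs_duration ge_min lexx orbT.
have key : {ae P, forall w,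
    xi w + typeI_hcs_duration X l T2 w + typeI_hcs_duration X r T1 w =
    order_stat X l w + T1 + typeI_hcs_duration X r T2 w}.
  near=> w.
  have [i Hl] := order_stat_is_observation X w ln'.
  have [j Hr] := order_stat_is_observation X w rn'.
  apply: typeII_uhcs_rule_min => //.
  - by apply: order_stat_increasing => //; near: w.
  - by rewrite Hl; move: i {Hl}; near: w.
  - by rewrite Hl; move: i {Hl}; near: w.
  - by rewrite Hr; move: j {Hr}; near: w.
  - by rewrite Hr; move: j {Hr}; near: w.
  - by near: w.
(* By [key], [xi] is almost surely the sum of three nonnegative terms: [X_{l:n} - X_{l:n} /\ T2],
   [T1 - X_{r:n} /\ T1] and [X_{r:n} /\ T2]. *)
have xi0 : {ae P, forall w, 0 <= xi w}.
  apply: filterS2 key (min0 r T2 rn' T20) => w keyw m0.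
  have : typeI_hcs_duration X l T2 w <= order_stat X l w by rewrite ge_min lexx.
  have : typeI_hcs_duration X r T1 w <= T1 by rewrite ge_min lexx orbT.
  lra.
have T1_ge0 : {ae P, forall w, 0 <= cst T1 w} by apply: aeW => w; exact: ltW.
have ae0D (f g : T -> R) : {ae P, forall w, 0 <= f w} ->
    {ae P, forall w, 0 <= g w} -> {ae P, forall w, 0 <= (f \+ g) w}.
  by move=> f0 g0; apply: filterS2 f0 g0 => w; exact: addr_ge0.
have mxi : measurable_fun [set: T] xi by [].
have mT1 : measurable_fun [set: T] (cst T1 : T -> R) by [].
have ml2 := mmin l T2 ln'.
have mr1 := mmin r T1 rn'.
have mr2 := mmin r T2 rn'.
have l20 := min0 l T2 ln' T20.
have r10 := min0 r T1 rn' T10.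
have r20 := min0 r T2 rn' T20.
have l0 := os0 l ln'.
have mL := measurable_funD mxi ml2.
have mR := measurable_funD ml mT1.
have := ae_eq_expectation (measurable_funD mL mr1) (measurable_funD mR mr2) key.
rewrite (ae_ge0_expectationD mL mr1 (ae0D _ _ xi0 l20) r10).
rewrite (ae_ge0_expectationD mxi ml2 xi0 l20).
rewrite (ae_ge0_expectationD mR mr2 (ae0D _ _ l0 T1_ge0) r20).
rewrite (ae_ge0_expectationD ml mT1 l0 T1_ge0).
rewrite expectation_cst -/(typeI_hcs_cost X l T2) -/(typeI_hcs_cost X r T1).
rewrite -/(typeI_hcs_cost X r T2) => <-.
(* Only the two subtracted costs need to be finite here; [addeAC] reorders them so that each cancels
   in turn. *)
rewrite [RHS]addeAC !addeK//; exact: minfin.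
Unshelve. all: by end_near.
Qed.
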